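(* For a tree $T$ with maximum degree $\Delta(T)$, $pn(\mathcal{E}_{c}(T))=\lceil\frac{\Delta(T)}{2}\rceil$.
   Context: Trees are finite. A book embedding of a graph consists of a linear order of its vertices (along the spine) together with an assignment of each edge to one of finitely many pages, such that no two edges assigned to the same page cross, where edges $ab$ and $cd$ cross iff their endpoints alternate in the linear order. The pagenumber $pn(G)$ is the minimum number of pages over all book embeddings of $G$. For a graph $G$, the complete expansion graph $\mathcal{E}_{c}(G)$ is the graph with vertex set $\{(v,e) : v\in V(G),\ e\in E(G),\ v \text{ is incident with } e\}$ and edge set $E_1\cup E_2$, where $E_1=\{(v,e)(v,f) : v\in V(G),\ e\neq f \in E(G) \text{ both incident with } v\}$ and $E_2=\{(v,e)(w,e) : e=vw\in E(G)\}$ (each vertex $v$ is replaced by a complete graph $K_{d_G(v)}$, and each edge $vw$ of $G$ becomes one edge joining these complete graphs).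
   Formalization: Trees with maximum degree Δ(T) = 3 are excluded: for them the claim is false, since the complete expansion has only K_2 and K_3 blocks, is outerplanar and has pagenumber 1, while ⌈3/2⌉ = 2 (e.g. T = K_{1,3}). *)

(* Defs.v *)
From mathcomp Require Import all_boot.

Set Implicit Arguments.
Unset Strict Implicit.
Unset Printing Implicit Defensive.

(** * Finite simple graphs *)

Record sgraph := SGraph {
  vertex :> finType;
  adj : rel vertex;
  adj_sym : symmetric adj;
  adj_irr : irreflexive adj
}.

Definition edges (G : sgraph) : {set {set G}} :=
  [set [set p.1; p.2] | p : G * G & adj p.1 p.2].

Definition edge (G : sgraph) : finType := {e : {set G} | e \in edges G}.

Definition degree (G : sgraph) (v : G) : nat := #|[set w : G | adj v w]|.

Definition max_degree (G : sgraph) : nat := \max_(v : G) degree v.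

(** * Trees *)

Definition connected (G : sgraph) : Prop :=
  0 < #|G| /\ forall x y : G, connect (@adj G) x y.

(* The bound on the length discards the closed walks x, y, x, which [ucycle]
   accepts as cycles of length 2. *)
Definition acyclic (G : sgraph) : Prop :=
  forall c : seq G, 2 < size c -> ~ ucycle (@adj G) c.

Definition is_tree (G : sgraph) : Prop := connected G /\ acyclic G.

(** * Book embeddings *)

(* The linear order along the spine is given by an injective position
   function [pos]. *)
Definition crossing (G : sgraph) (pos : G -> 'I_#|G|) (e f : {set G}) : bool :=
  [exists a, exists b, exists c, exists d,
     [&& e == [set a; b], f == [set c; d]
       & (pos a < pos c < pos b) && (pos b < pos d)
         || (pos c < pos a < pos d) && (pos d < pos b)]].

Definition book_embedding (G : sgraph) (k : nat)
    (pos : {ffun G -> 'I_#|G|}) (page : {ffun edge G -> 'I_k}) : bool :=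
  injectiveb pos &&
  [forall e : edge G, forall f : edge G,
     (page e == page f) ==> ~~ crossing pos (val e) (val f)].

Definition has_book (G : sgraph) (k : nat) : bool :=
  [exists pos : {ffun G -> 'I_#|G|}, exists page : {ffun edge G -> 'I_k},
     book_embedding pos page].

Lemma crossing_irr (G : sgraph) (pos : G -> 'I_#|G|) (e : {set G}) :
  ~~ crossing pos e e.
Proof.
apply/negP => /existsP[a /existsP[b /existsP[c /existsP[d]]]].
case/and3P=> /eqP-> /eqP eq_e alt.
have : c \in [set a; b] by rewrite eq_e set21.
have : d \in [set a; b] by rewrite eq_e set22.
rewrite !inE => /orP[]/eqP ? /orP[]/eqP ?; subst c d;
  by move: alt; rewrite !ltnn ?andbF //= => /andP[/ltn_trans lt1 /lt1];
     rewrite ltnn.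
Qed.

Lemma exists_book (G : sgraph) : exists k, has_book G k.
Proof.
exists #|edge G|.
apply/existsP; exists [ffun v => enum_rank v].
apply/existsP; exists [ffun e => enum_rank e].
apply/andP; split.
  by apply/injectiveP => x y; rewrite !ffunE => /enum_rank_inj.
apply/forallP => e; apply/forallP => f; apply/implyP.
by rewrite !ffunE => /eqP/enum_rank_inj->; exact: crossing_irr.
Qed.

Definition pagenumber (G : sgraph) : nat := ex_minn (exists_book G).

(** * The complete expansion graph *)

Definition flag (G : sgraph) : finType :=
  {p : G * edge G | p.1 \in val p.2}.

Definition expansion_adj (G : sgraph) : rel (flag G) := fun p q =>
  let: (v, e) := val p in let: (w, f) := val q in
  (v == w) && (e != f) || (e == f) && (val e == [set v; w]).

Lemma edge_loopless (G : sgraph) (e : edge G) (v : G) : val e != [set v; v].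
Proof.
apply/eqP => eq_e; have /imsetP[[x y]] := valP e; rewrite eq_e inE /=.
move=> xy eq_s; have : x \in [set v; v] by rewrite eq_s set21.
have : y \in [set v; v] by rewrite eq_s set22.
by rewrite !inE !orbb => /eqP eqy /eqP eqx; rewrite eqx eqy adj_irr in xy.
Qed.

Lemma expansion_adj_sym (G : sgraph) : symmetric (@expansion_adj G).
Proof.
move=> [[v e] /= ve] [[w f] /= wf]; rewrite /expansion_adj /=.
rewrite (eq_sym v) (eq_sym e) setUC.
by case: (eqVneq f e) => // ->.
Qed.

Lemma expansion_adj_irr (G : sgraph) : irreflexive (@expansion_adj G).
Proof.
move=> [[v e] /= ve]; rewrite /expansion_adj /= !eqxx /=.
exact/negbTE/edge_loopless.
Qed.

Definition complete_expansion (G : sgraph) : sgraph :=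
  SGraph (@expansion_adj_sym G) (@expansion_adj_irr G).

(* Main.v *)
(** Lower bound: the clique replacing a vertex of maximum degree n is convex along the spine; for
    n >= 4 each page contains at most two of its n half-turn diagonals, so n <= 2k.
    Upper bound: a depth-first traversal places the two ends of every tree edge next to each other
    and lets no two vertex cliques alternate, so only chords of one and the same clique can cross.
    Each clique is then a subset of a convex K_2k, which has the zigzag embedding in k pages. *)

Require Import Defs.
From mathcomp Require Import all_boot.
From mathcomp Require Import zify.

Set Implicit Arguments.
Unset Strict Implicit.
Unset Printing Implicit Defensive.

(** * Edges and book embeddings *)

Lemma edges_adj (G : sgraph) (a b : G) : adj a b -> [set a; b] \in edges G.
Proof. by move=> ab; apply/imsetP; exists (a, b); rewrite ?inE. Qed.

Lemma edgesP (G : sgraph) (e : {set G}) :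
  reflect (exists a b, adj a b /\ e = [set a; b]) (e \in edges G).
Proof.
apply: (iffP imsetP) => [[[a b]]|[a [b [ab ->]]]].
  by rewrite inE /= => ab ->; exists a, b.
by exists (a, b); rewrite ?inE.
Qed.

Lemma set2_inj (T : finType) (a b c d : T) :
  [set a; b] = [set c; d] -> (a = c /\ b = d) \/ (a = d /\ b = c).
Proof.
move=> /setP E.
move: (E a) (E b) (E c) (E d); rewrite !inE !eqxx ?orbT /=.
move=> /esym/orP[/eqP->|/eqP->] /esym/orP[/eqP->|/eqP->]; rewrite ?orbb.
- by move=> _ /eqP->; left.
- by left.
- by right.
- by move=> /eqP->; left.
Qed.

(** Positions may be any naturals: counting the vertices that lie before turns them into ordinals in
    the same order. One alternation pattern is enough, as exchanging the two edges gives the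
    other. *)
Lemma has_bookP (G : sgraph) k :
  reflect (exists (pos : G -> nat) (page : {set G} -> nat),
    [/\ injective pos,
        forall a b, adj a b -> page [set a; b] < k &
        forall a b c d, adj a b -> adj c d ->
          pos a < pos c -> pos c < pos b -> pos b < pos d ->
          page [set a; b] <> page [set c; d]])
  (has_book G k).
Proof.
apply: (iffP existsP) => [[pos /existsP[page /andP[/injectiveP injp /forallP cr]]]|].
  exists (fun x => nat_of_ord (pos x)).
  (* The value 0 off the edges is never read, since both conditions on the page concern adjacent
     pairs. *)
  exists (fun e => if insub e is Some e' then nat_of_ord (page e') else 0).
  split=> [x y /val_inj/injp // | a b ab | a b c d ab cd ac cb bd].
    by rewrite insubT ?edges_adj.
  rewrite (insubT (fun e => e \in edges G) (edges_adj ab)).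
  rewrite (insubT (fun e => e \in edges G) (edges_adj cd)) => /val_inj E.
  move: cr => /(_ (Sub [set a; b] (edges_adj ab)))/forallP.
  move=> /(_ (Sub [set c; d] (edges_adj cd))); rewrite E eqxx /=.
  move=> /negP; apply; do 4!(apply/existsP; eexists).
  by apply/and3P; split; [exact: eqxx | exact: eqxx | rewrite ac cb bd].
case=> pos [page [injp lt_page cr]].
have ltp x : #|[set y | pos y < pos x]| < #|G|.
  rewrite -cardsT; apply: proper_card; apply/properP; split; first exact: subsetT.
  by exists x; rewrite ?inE ?ltnn.
pose p : {ffun G -> 'I_#|G|} := [ffun x => Ordinal (ltp x)].
have pE x y : (p x < p y) = (pos x < pos y).
  rewrite !ffunE /=; case: (ltnP (pos x) (pos y)) => [xy | yx].
    apply: proper_card; apply/properP; split.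
      by apply/subsetP => z; rewrite !inE => /ltn_trans; apply.
    by exists x; rewrite !inE ?ltnn.
  apply/negbTE; rewrite -leqNgt; apply/subset_leq_card/subsetP => z; rewrite !inE.
  by move=> /leq_trans; apply.
have ltq (e : edge G) : page (val e) < k.
  by case/edgesP: (valP e) => a [b [ab ->]]; exact: lt_page.
exists p; apply/existsP; exists [ffun e => Ordinal (ltq e)].
apply/andP; split.
  apply/injectiveP => x y xy; apply: injp; apply/eqP.
  by rewrite eqn_leq leqNgt -pE xy ltnn leqNgt -pE xy ltnn.
apply/forallP => e; apply/forallP => f; apply/implyP.
rewrite !ffunE => /eqP[] ef; apply/negP.
move=> /existsP[a /existsP[b /existsP[c /existsP[d]]]].
case/and3P => /eqP E /eqP F; rewrite !pE.
have ab : adj a b.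
  case/edgesP: (valP e) => x [y [xy]]; rewrite E.
  by case/set2_inj => -[-> ->] //; rewrite adj_sym.
have cd : adj c d.
  case/edgesP: (valP f) => x [y [xy]]; rewrite F.
  by case/set2_inj => -[-> ->] //; rewrite adj_sym.
case/orP => /andP[/andP[h1 h2] h3].
  by apply: (cr a b c d) => //; rewrite -E -F.
by apply: (cr c d a b) => //; rewrite -E -F.
Qed.

(** * Lower bound for a clique *)

(** Pigeonhole: each of the [k] values is taken at most twice. *)
Lemma three_in_fibre n k (f : 'I_n -> nat) :
  (forall i, f i < k) ->
  (forall i j l : 'I_n, i < j -> j < l -> f i = f j -> f j = f l -> False) ->
  n <= k.*2.
Proof.
move=> fk no3.
pose A (p : 'I_k) := [set i : 'I_n | f i == p].
have ->: n = \sum_(p < k) #|A p|.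
  rewrite -[LHS]card_ord -sum1_card.
  rewrite (partition_big (fun i => Ordinal (fk i)) predT) //=.
  apply: eq_bigr => p _; rewrite sum1dep_card; apply: eq_card => i.
  by rewrite !inE -val_eqE.
rewrite -[k in k.*2]card_ord -muln2 -sum_nat_const.
apply: leq_sum => p _; rewrite leqNgt; apply/negP => A3.
pose s := [seq val i | i <- enum (A p)].
have ss : sorted ltn s.
  apply: (subseq_sorted ltn_trans (s2 := iota 0 n)); last exact: iota_ltn_sorted.
  rewrite -val_enum_ord; apply: map_subseq.
  by rewrite [enum 'I_n]enumT; exact: filter_subseq.
have sz : size s = #|A p| by rewrite size_map -cardE.
have inA i : i \in enum (A p) -> f i = p by rewrite mem_enum inE => /eqP.
move: A3 ss inA; rewrite -{}sz {}/s.
case: (enum (A p)) => [|i [|j [|l t]]] //= _ /and3P[ij jl _] inA.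
by apply: (no3 i j l); rewrite // !inA ?inE ?eqxx ?orbT.
Qed.

(* The diagonals {i, i + n/2} (indices mod n): two of them that do not cross
   share an end, and no three pairwise do so once n >= 4. *)
Lemma clique_pages (G : sgraph) k (s : seq G) :
  has_book G k -> uniq s -> {in s &, forall x y, x != y -> adj x y} ->
  3 < size s -> uphalf (size s) <= k.
Proof.
move=> /has_bookP[pos [page [injp lt_page cr]]] us clq s4.
pose le := [rel x y | pos x <= pos y].
have le_tot : total le by move=> x y; exact: leq_total.
pose t := sort le s.
have pt : perm_eq t s by rewrite perm_sort.
have ut : uniq t by rewrite sort_uniq.
have st : size t = size s by rewrite size_sort.
have x0 : G by case: (s) s4.
pose v i := nth x0 t i.
have posv i j : i < j -> j < size s -> pos (v i) < pos (v j).
  move=> ij js; rewrite ltn_neqAle (inj_eq injp) nth_uniq ?st //; last by lia.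
  rewrite neq_ltn ij /=.
  have := sort_sorted le_tot s => /(sorted_leq_nth (leT := le)).
  move=> /(_ (fun y x z => @leq_trans (pos y) (pos x) (pos z)) (fun x => leqnn (pos x)) x0 i j).
  by rewrite !inE !size_sort; apply; lia.
have adjv i j : i < j -> j < size s -> adj (v i) (v j).
  move=> ij js; apply: clq.
  - by rewrite -(perm_mem pt) mem_nth // st; lia.
  - by rewrite -(perm_mem pt) mem_nth // st.
  - by rewrite nth_uniq ?st //; lia.
have crv a b c d : a < c -> c < b -> b < d -> d < size s ->
    page [set v a; v b] <> page [set v c; v d].
  by move=> ac cb bd dn; apply: cr; (apply: adjv || apply: posv); lia.
set n := size s in s4 posv adjv crv st *.
pose m := n./2; pose u := uphalf n.
have um : u + m = n by rewrite /u /m uphalf_half -addnA addnn odd_double_half.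
have um1 : m <= u <= m.+1 by rewrite /u /m uphalf_half; case: (odd n); lia.
(* The ends of diagonal [i] in increasing order: [i + m] reaches [n] exactly from [i = u] on, where
   it wraps to [i - u]. For even [n] each diagonal occurs at two indices. *)
pose d i := if i < u then (i, i + m) else (i - u, i).
have d_lt i : i < n -> (d i).1 < (d i).2 < n.
  by move=> ni; rewrite /d; case: (ltnP i u) => iu /=; lia.
pose f (i : 'I_n) := page [set v (d i).1; v (d i).2].
(* Diagonals on one page do not cross, hence share an end, so their indices differ by [m] or by
   [n - m = u]. *)
have fdist (i j : 'I_n) : i < j -> f i = f j -> (j - i == m) || (j - i == u).
  move=> ij; apply: contra_eqT => /norP[/eqP jm /eqP ju].
  apply/eqP; rewrite /f /d.
  have jn := ltn_ord j.
  case: (ltnP i u) => iu; case: (ltnP j u) => ju' /=; try lia.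
  - by apply: crv; lia.
  - case: (ltnP (j - u) i) => h; last by apply: crv; lia.
    by apply/nesym/crv; lia.
  - by apply: crv; lia.
have : n <= k.*2.
  apply: (@three_in_fibre n k f) => [i|i j l ij jl fij fjl].
    by have /andP[h1 h2] := d_lt i (ltn_ord i); apply/lt_page/adjv.
  (* All three gaps would be [m] or [u], yet two of them add up to the third, and [2m > m + 1 >= u]
     because [n >= 4] gives [m >= 2]. *)
  have := fdist _ _ ij fij; have := fdist _ _ jl fjl.
  have := fdist _ _ (ltn_trans ij jl) (etrans fij fjl).
  by lia.
by move=> nk; have := um1; rewrite -/u; lia.
Qed.

(** * Words without alternation *)

Section Alternation.
Variable T : eqType.
Implicit Types (u t : seq T) (a b v w x : T).

(** Equivalently, the classes of positions with equal letters form a noncrossing partition. *)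
Definition alternation_free u := forall a b, a != b -> ~~ subseq [:: a; b; a; b] u.

(** Neighbours in [t] differ, so an embedding of [t] uses at most one of the two adjacent copies of
    [v]. *)
Lemma subseq_collapse v t u1 u2 :
  sorted (fun x y => x != y) t ->
  subseq t (u1 ++ v :: v :: u2) -> subseq t (u1 ++ v :: u2).
Proof.
elim: u1 t => [|x u1 IH] [|y t] //= pt; last first.
  by case: eqP => _; apply: IH => //; exact: path_sorted pt.
case: (eqVneq y v) => [yv|/negbTE yv]; last by rewrite yv.
case: t pt => [|z t] /=; rewrite ?sub0seq // -yv => /andP[yz _].
by rewrite eq_sym (negbTE yz).
Qed.

(** An alternation uses each of its letters twice, so it avoids [w] and survives the deletion of
    [w]. *)
Lemma alternation_free_once w u1 u2 :
  w \notin u1 ++ u2 -> alternation_free (u1 ++ u2) -> alternation_free (u1 ++ w :: u2).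
Proof.
move=> wu fr a b ab; apply/negP => sub.
have c1 : count_mem w (u1 ++ w :: u2) = 1.
  by have := count_memPn wu; rewrite !count_cat /= eqxx; lia.
have cw x : 1 < count_mem x [:: a; b; a; b] -> x != w.
  move=> h; apply/eqP => xw.
  have [m sm E] := subseqP sub.
  have := @leq_count_mask _ (pred1 w) m (u1 ++ w :: u2).
  by rewrite c1 -E -xw leqNgt h.
have aw : a != w by apply: cw => /=; rewrite eqxx; lia.
have bw : b != w by apply: cw => /=; rewrite eqxx; lia.
move: (fr a b ab) => /negP; apply.
have := subseq_trans (_ : subseq [:: a; b; a; b] (filter (predC1 w) (u1 ++ w :: u2))).
apply; first by rewrite subseq_filter sub /= aw bw.
by rewrite filter_cat /= eqxx /= -filter_cat filter_subseq.
Qed.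

Lemma alternation_free_double v u1 u2 :
  alternation_free (u1 ++ v :: u2) -> alternation_free (u1 ++ v :: v :: u2).
Proof.
move=> fr a b ab; apply: contra (fr a b ab) => /subseq_collapse; apply.
by rewrite /= ab eq_sym ab.
Qed.

Lemma alternation_free_nth (u : seq T) x0 i j k l a b :
  alternation_free u -> i < j -> j < k -> k < l -> l < size u ->
  nth x0 u i = a -> nth x0 u j = b -> nth x0 u k = a -> nth x0 u l = b -> a = b.
Proof.
move=> fr ij jk kl lu ai bj ak bl; apply/eqP/negPn/negP => /fr/negP; apply.
have sub : subseq [:: i; j; k; l] (iota 0 (size u)).
  rewrite -[X in subseq X _](_ : [seq n <- iota 0 (size u) | n \in [:: i; j; k; l]] = _).
    exact: filter_subseq.
  apply: (irr_sorted_eq ltn_trans ltnn).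
  - by apply: sorted_filter (iota_ltn_sorted _ _); exact: ltn_trans.
  - by rewrite /= ij jk kl.
  - by move=> n; rewrite mem_filter mem_iota !inE; lia.
have := map_subseq (nth x0 u) sub.
by rewrite /= ai bj ak bl map_nth_iota0 // take_size.
Qed.

End Alternation.

(** * Words of darts *)

Section Darts.
Variable T : eqType.
Implicit Types (s : seq (T * T)).

(* The flag (v, vw) is encoded by the dart (v, w), so an oriented edge (a, b)
   lays its two flags consecutively along the spine. *)
Definition dart_word s := flatten [seq [:: d; (d.2, d.1)] | d <- s].

Lemma dart_word_cons a b s :
  dart_word ((a, b) :: s) = [:: (a, b), (b, a) & dart_word s].
Proof. by []. Qed.

Lemma dart_word_cat s1 s2 : dart_word (s1 ++ s2) = dart_word s1 ++ dart_word s2.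
Proof. by rewrite /dart_word map_cat flatten_cat. Qed.

Lemma mem_dart_word s a b :
  ((a, b) \in dart_word s) = ((a, b) \in s) || ((b, a) \in s).
Proof.
elim: s => //= -[x y] s; rewrite /dart_word /= !inE => ->.
by rewrite !xpair_eqE; do ![case: eqP => _]; rewrite /= ?orbT ?orbF //.
Qed.

(** Makes the two flags of a tree edge neighbours on the spine, so that nothing crosses the edge
    joining them. *)
Lemma index_dart_word s a b : uniq (dart_word s) -> (a, b) \in s ->
  index (b, a) (dart_word s) = (index (a, b) (dart_word s)).+1.
Proof.
move=> + /splitPr E; case: E => s1 s2; rewrite dart_word_cat dart_word_cons.
rewrite cat_uniq /= => /and3P[_ /norP[ab /norP[ba _]] /andP[]].
rewrite inE => /norP[nab _] _; rewrite !index_cat (negbTE ab) (negbTE ba) /=.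
by rewrite !eqxx (negbTE nab) addn0 addn1.
Qed.

End Darts.

(** * Spine order of a tree *)

Section SpineOrder.
Variable T : sgraph.
Implicit Types (S : {set T}) (s : seq (T * T)).

Definition induced S : rel T := fun a b => [&& a \in S, b \in S & adj a b].

Definition induced_connected S :=
  forall x y, x \in S -> y \in S -> connect (induced S) x y.

(** First components name the tree vertex that owns each flag; the last clause says that no two
    cliques alternate. *)
Definition spine_order S s :=
  [/\ uniq (dart_word s), forall a b, ((a, b) \in dart_word s) = induced S a b
    & alternation_free [seq d.1 | d <- dart_word s]].

(** Otherwise [S] would be closed under adjacency, hence everything. *)
Lemma exists_boundary_edge S :
  connected T -> S != set0 -> S != [set: T] ->
  exists v w, [/\ v \in S, w \notin S & adj v w].
Proof.
move=> [_ conn] /set0Pn[x xS] SnT.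
have [y yS] : exists y, y \notin S.
  apply/existsP; apply: contraNT SnT => /existsPn all_in.
  by apply/eqP/setP => y; rewrite inE; move: (all_in y); rewrite negbK.
have [/existsP[v /existsP[w /and3P[]]]|none] :=
    boolP [exists v, exists w, [&& v \in S, w \notin S & adj v w]].
  by exists v, w.
have cl : closed (@adj T) (mem S).
  apply: (intro_closed (sym_connect_sym (@adj_sym T))) => v w vw vS.
  apply: contraNT none => wS; apply/existsP; exists v; apply/existsP; exists w.
  by rewrite vS wS vw.
by move: yS; have /= <- := closed_connect cl (conn x y); rewrite xS.
Qed.

(** Two such neighbours, joined by a simple path inside [S], would close a cycle through [w]. *)
Lemma boundary_neighbour_uniq S v v' w :
  acyclic T -> induced_connected S -> v \in S -> v' \in S -> w \notin S ->
  adj v w -> adj v' w -> v' = v.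
Proof.
move=> acy conn vS v'S wS vw v'w; apply/eqP/negPn/negP => nv.
have /connectP[p0 pth0 lst0] := conn v v' vS v'S.
case/shortenP: pth0 lst0 => p pth up _ lst.
have pS : {subset v :: p <= S}.
  move: pth; elim: (p) (v) vS => [|z q IH] x xS /=.
    by move=> _ y; rewrite inE => /eqP->.
  move=> /andP[/and3P[_ zS _] /(IH _ zS) qS] y.
  by rewrite inE => /predU1P[->|/qS].
apply: (acy [:: w, v & p]).
  by case: (p) lst nv => //= E; rewrite E eqxx.
apply/andP; split; last first.
  by rewrite /= in up *; rewrite up andbT; apply: contra wS => /pS.
rewrite /= adj_sym vw rcons_path -lst v'w andbT.
by apply: sub_path pth => x y /and3P[].
Qed.

(** The two new flags enter beside an existing flag of [v]: the word of owners only gets one letter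
    [v] doubled and one letter [w] inserted, and neither creates an alternation. *)
Lemma spine_order_leaf S s v w :
  spine_order S s -> v \in S -> w \notin S -> adj v w ->
  (forall v', v' \in S -> adj v' w -> v' = v) ->
  exists s', spine_order (w |: S) s'.
Proof.
move=> [us ms fr] vS wS vw only.
have nvw : v != w by apply: contraNneq wS => <-.
(* The first two clauses of [spine_order] depend on the word only up to permutation. *)
have new s' : perm_eq (dart_word s') [:: (v, w), (w, v) & dart_word s] ->
    alternation_free [seq d.1 | d <- dart_word s'] -> spine_order (w |: S) s'.
  move=> ps' fr'; split=> //.
    rewrite (perm_uniq ps') /= us !inE !ms /induced (negbTE wS) xpair_eqE.
    by rewrite (negbTE nvw) andbF.
  move=> a b; rewrite (perm_mem ps') !inE ms /induced !inE !xpair_eqE.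
  have [->|aw] := eqVneq a w; have [->|bw] := eqVneq b w.
  - by rewrite adj_irr (negbTE wS) eq_sym (negbTE nvw).
  - rewrite (negbTE wS) eq_sym (negbTE nvw) /= orbF.
    apply/eqP/andP => [->|[bS wb]]; first by rewrite adj_sym.
    by apply: only; rewrite // adj_sym.
  - rewrite (negbTE wS) andbF orbF /= !andbT orbF.
    by apply/eqP/andP => [->|[aS wa]] //; apply: only.
  - by rewrite !andbF.
have wD : w \notin [seq d.1 | d <- dart_word s].
  apply/mapP => -[[a b]]; rewrite ms /= => /and3P[aS _ _] E.
  by move: wS; rewrite E aS.
have [/mapP[[v' x]]|vD] := boolP (v \in [seq d.1 | d <- dart_word s]); last first.
  (* With no flag of [v] so far, both letters are new and occur once. *)
  exists ((v, w) :: s); first apply: new => //.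
  rewrite dart_word_cons /=.
  apply: (@alternation_free_once _ v [::]); first by rewrite !inE negb_or nvw.
  exact: (@alternation_free_once _ w [::]).
rewrite mem_dart_word /= => + E; rewrite -{v'}E.
(* The new pair is oriented so that the two [v] touch: owners read [w v v x] around an edge [(v, x)]
   and [x v v w] around [(x, v)]. *)
case/orP => /splitPr E; case: E new us ms fr wD => s1 s2 new _ _ fr wD.
  exists (s1 ++ [:: (w, v), (v, x) & s2]); apply: new.
    rewrite !dart_word_cat !dart_word_cons; apply/permP => P.
    by rewrite /= !count_cat /=; lia.
  move: fr wD; rewrite !dart_word_cat !dart_word_cons !map_cat /=.
  move=> /alternation_free_double fr wD; apply: alternation_free_once fr.
  by move: wD; rewrite !mem_cat !inE; case: eqP.
exists (s1 ++ [:: (x, v), (v, w) & s2]); apply: new.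
  rewrite !dart_word_cat !dart_word_cons; apply/permP => P.
  by rewrite /= !count_cat /=; lia.
move: fr wD; rewrite !dart_word_cat !dart_word_cons !map_cat /=.
rewrite -cat_rcons => /alternation_free_double fr wD.
rewrite -3!cat_rcons; apply: alternation_free_once; last by rewrite !cat_rcons in fr *.
by move: wD; rewrite !(mem_cat, mem_rcons, inE); do 2!case: (w \in _); do 2!case: (w == _).
Qed.

(** A connected set grows from one vertex by outside neighbours, each a leaf of the enlarged set by
    acyclicity. *)
Lemma spine_order_exists : is_tree T -> exists s, spine_order [set: T] s.
Proof.
move=> [conn acy].
have grow n : n < #|T| ->
    exists S s, [/\ #|S| = n.+1, induced_connected S & spine_order S s].
  elim: n => [|n IH] nT.
    have [x _] := card_gt0P nT; exists [set x], [::]; split.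
    - exact: cards1.
    - by move=> a b; rewrite !inE => /eqP-> /eqP->; exact: connect0.
    - split=> // a b; rewrite /induced !inE.
      by apply/esym/negbTE/and3P => -[/eqP-> /eqP->]; rewrite adj_irr.
  have [|S [s [cS conS oS]]] := IH; first exact: ltnW.
  have [||v [w [vS wS vw]]] := exists_boundary_edge conn (S := S).
  - by rewrite -card_gt0 cS.
  - by apply: contraTneq nT => ST; rewrite -cardsT -ST cS ltnn.
  have only v' : v' \in S -> adj v' w -> v' = v.
    by move=> v'S; exact: (boundary_neighbour_uniq acy conS vS v'S wS vw).
  have [s' oS'] := spine_order_leaf oS vS wS vw only.
  exists (w |: S), s'; split=> //; first by rewrite cardsU1 wS cS.
  have sym : connect_sym (induced (w |: S)).
    by apply: sym_connect_sym => a b; rewrite /induced adj_sym andbCA.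
  have to_v x : x \in w |: S -> connect (induced (w |: S)) v x.
    rewrite !inE => /predU1P[->|xS].
      by apply: connect1; rewrite /induced !inE vS eqxx orbT.
    apply: connect_sub (conS v x vS xS) => a b /and3P[aS bS ab].
    by apply: connect1; rewrite /induced !inE aS bS !orbT.
  by move=> x y /to_v xv /to_v; apply: connect_trans; rewrite sym.
have [T0 _] := conn.
have [|S [s [cS _ oS]]] := grow #|T|.-1; first by rewrite prednK.
suff <- : S = [set: T] by exists s.
by apply/eqP; rewrite eqEcard subsetT cardsT cS prednK /= ?leqnn.
Qed.

End SpineOrder.

(** * Flags as darts *)

Section Flags.
Variable T : sgraph.
Implicit Types p q : flag T.

(** The default of [odflt] is never reached, as the edge of a flag always has a second end. *)
Definition dart p : T * T :=
  ((val p).1, odflt (val p).1 [pick w | val (val p).2 == [set (val p).1; w]]).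

Lemma dartE p : val (val p).2 = [set (dart p).1; (dart p).2].
Proof.
rewrite /dart /=; case: pickP => [w /eqP //|none].
have /edgesP[a [b [_ E]]] := valP (val p).2.
move: (valP p); rewrite E !inE => /orP[]/eqP pE.
  by move: (none b); rewrite E pE eqxx.
by move: (none a); rewrite E pE setUC eqxx.
Qed.

Lemma adj_dart p : adj (dart p).1 (dart p).2.
Proof.
have /edgesP[a [b [ab]]] := valP (val p).2.
by rewrite dartE => /set2_inj[[-> ->]|[-> ->]] //; rewrite adj_sym.
Qed.

Lemma dart_inj : injective dart.
Proof.
move=> p q pq; apply: val_inj; move: (dartE p) (dartE q); rewrite pq => <-.
have : (dart p).1 = (dart q).1 by rewrite pq.
rewrite /=; case: (val p) => a e; case: (val q) => b f /= -> /val_inj->.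
by [].
Qed.

Lemma dart_surj v w : adj v w -> exists p, dart p = (v, w).
Proof.
move=> vw; have vS : v \in [set v; w] by rewrite set21.
exists (Sub (v, Sub [set v; w] (edges_adj vw)) vS : flag T).
set p := Sub _ _; have d1 : (dart p).1 = v by [].
have := adj_dart p; have : [set v; w] = [set (dart p).1; (dart p).2] := dartE p.
case: (dart p) d1 => a b /= ->.
by move=> /set2_inj[[_ <-]|[<- _]]; rewrite ?adj_irr.
Qed.

Lemma expansion_adjP p q : expansion_adj p q ->
  ((dart p).1 = (dart q).1 /\ p != q) \/ dart q = ((dart p).2, (dart p).1).
Proof.
move=> pq; have npq : p != q by apply: contraTneq pq => ->; rewrite expansion_adj_irr.
move: pq (dartE p) (dartE q) (adj_dart p).
rewrite /expansion_adj [dart q]surjective_pairing.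
have -> : (dart p).1 = (val p).1 by [].
have -> : (dart q).1 = (val q).1 by [].
case: (val p) => v e; case: (val q) => w f /= /orP[/andP[/eqP->]|]; first by left.
move=> /andP[/eqP-> /eqP->] /set2_inj[[_ <-]|[<- ->]]; last by rewrite adj_irr.
move=> /set2_inj[[-> <-]|[-> _]] vw; last by right.
by rewrite adj_irr in vw.
Qed.

Lemma expansion_adj_clique p q : (dart p).1 = (dart q).1 -> p != q -> expansion_adj p q.
Proof.
move=> pq npq; rewrite /expansion_adj; apply: contraNT npq.
move: pq; have -> : (dart p).1 = (val p).1 by [].
have -> : (dart q).1 = (val q).1 by [].
rewrite -(inj_eq val_inj).
case: (val p) => v e; case: (val q) => w f /= ->.
by rewrite eqxx xpair_eqE eqxx /= => /norP[/negbNE].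
Qed.

Lemma expansion_adj_flip p q :
  dart q = ((dart p).2, (dart p).1) -> expansion_adj p q.
Proof.
move=> pq; have qv : (val q).1 = (dart p).2 := congr1 fst pq.
have pv : (val p).1 = (dart p).1 by [].
have E : (val p).2 = (val q).2 by apply: val_inj; rewrite dartE (dartE q) pq setUC.
rewrite /expansion_adj; move: pv qv E (dartE p).
case: (val p) => v e; case: (val q) => w f.
move=> /= -> -> ->; rewrite eqxx => ->.
by rewrite eqxx orbT.
Qed.

Lemma card_flags_at v : degree v <= #|[set p : flag T | (dart p).1 == v]|.
Proof.
apply: leq_trans (leq_imset_card (fun p => (dart p).2) _).
apply: subset_leq_card; apply/subsetP => w; rewrite inE => /dart_surj[p E].
by apply/imsetP; exists p; rewrite ?inE E.
Qed.

End Flags.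

(** * Page assignment and the two bounds *)

(* Chords of the convex 2n-gon whose sums of ends agree modulo 2n are parallel,
   and two consecutive residues together form a zigzag path. *)
Lemma zigzag_crossing n i j k l :
  i < j -> j < k -> k < l -> l < n.*2 ->
  ((i + k) %% n.*2)./2 <> ((j + l) %% n.*2)./2.
Proof.
move=> ij jk kl ln.
have red x : x < n.*2 + n.*2 -> x %% n.*2 = if x < n.*2 then x else x - n.*2.
  move=> xn; case: ltnP => nx; first by rewrite modn_small.
  by rewrite -{1}(subnK nx) modnDr modn_small //; lia.
(* The second sum exceeds the first by at least 2 and at most [2n - 2], so the residues are at least
   2 apart. *)
by rewrite !red; [do 2!case: ltnP => ?; lia | lia | lia].
Qed.

Lemma degree_max (T : sgraph) (v : T) : degree v <= max_degree T.
Proof. exact: (leq_bigmax (F := @degree T)). Qed.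

Lemma has_book_expansion (T : sgraph) k :
  is_tree T -> max_degree T <= k.*2 -> has_book (complete_expansion T) k.
Proof.
move=> /spine_order_exists[s [us ms fr]] Dk; apply/has_bookP.
pose D := dart_word s.
pose pos (p : flag T) := index (dart p) D.
have inD p : dart p \in D.
  by rewrite [dart p]surjective_pairing ms /induced !inE adj_dart.
have posD p : pos p < size D by rewrite index_mem.
have ownerE x0 p : nth x0 [seq d.1 | d <- D] (pos p) = (dart p).1.
  by rewrite (nth_map (dart p)) // nth_index.
have injpos : injective pos.
  move=> p q E; apply: dart_inj; rewrite -(nth_index (dart p) (inD p)).
  by rewrite -/(pos p) E nth_index.
(* The corner of the convex [2k]-gon taken by [p]: the number of earlier flags in its clique. *)
pose rank (p : flag T) := count (fun d => d.1 == (dart p).1) (take (pos p) D).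
have rank_mono p q : (dart p).1 = (dart q).1 -> pos p < pos q -> rank p < rank q.
  move=> E pq; rewrite /rank -E -(subnKC pq) takeD count_cat.
  rewrite (take_nth (dart p)) // -cats1 count_cat /= nth_index // eqxx; lia.
have rankD p : rank p < k.*2.
  apply: leq_trans Dk; apply: leq_trans (degree_max (dart p).1).
  have: rank p < count (fun d => d.1 == (dart p).1) D.
    rewrite -[X in _ < count _ X](cat_take_drop (pos p)) count_cat (drop_nth (dart p)) //=.
    by rewrite nth_index // eqxx addnA addn1 ltnS leq_addr.
  move=> /leq_trans; apply; rewrite -size_filter -(size_map snd) /degree cardE.
  apply: uniq_leq_size => [|b].
    rewrite map_inj_in_uniq ?filter_uniq // => -[a b] [a' b'].
    by rewrite !mem_filter /= => /andP[/eqP-> _] /andP[/eqP-> _] ->.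
  rewrite mem_enum inE => /mapP[[a b']]; rewrite mem_filter /= ms /induced !inE.
  by move=> /andP[/eqP-> ?] ->.
have tree_edge p q : dart q = ((dart p).2, (dart p).1) ->
    pos q = (pos p).+1 \/ pos p = (pos q).+1.
  move=> E; move: (inD p); rewrite /pos E [dart p]surjective_pairing /=.
  rewrite mem_dart_word => /orP[] h; have := index_dart_word us h; first by left.
  by right.
(* Summing over the edge as a set makes the page symmetric in the ends. *)
pose page (e : {set flag T}) := ((\sum_(p in e) rank p) %% k.*2)./2.
have pageE p q : p != q -> page [set p; q] = ((rank p + rank q) %% k.*2)./2.
  by move=> pq; rewrite /page big_setU1 ?inE // big_set1.
exists pos, page; split=> //.
  move=> p q _; rewrite /page; set x := \sum_(r in _) _.
  have k2 : 0 < k.*2 by apply: leq_ltn_trans (rankD p).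
  by have := ltn_pmod x k2; lia.
move=> a b c d /expansion_adjP ab /expansion_adjP cd ac cb bd.
(* A tree edge joins spine neighbours, leaving no room for an end of a crossing edge. *)
case: ab => [[oab nab]|/tree_edge]; last by lia.
case: cd => [[ocd ncd]|/tree_edge]; last by lia.
(* The owners of [a], [c], [b], [d] alternate along the spine, so they coincide. *)
have oac : (dart a).1 = (dart c).1.
  apply: (alternation_free_nth (x0 := (dart a).1) fr ac cb bd); rewrite ?size_map //.
  - by rewrite -/D ownerE -oab.
  - by rewrite -/D ownerE -ocd.
rewrite !pageE //; apply: zigzag_crossing => //.
- exact: rank_mono.
- by apply: rank_mono => //; rewrite -oac.
- by apply: rank_mono => //; rewrite -oab oac.
Qed.

(** Degree 3 is a genuine exception: the star with three leaves expands to a triangle with pendant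
    edges, which fits on one page, while [uphalf 3 = 2]. *)
Lemma book_expansion_lower (T : sgraph) k :
  max_degree T <> 3 -> has_book (complete_expansion T) k -> uphalf (max_degree T) <= k.
Proof.
move=> D3 bk.
have [->//|D0] := posnP (max_degree T).
have T0 : 0 < #|T|.
  rewrite lt0n; apply: contraTneq D0 => T0.
  by rewrite /max_degree big_pred0 // => x; have := fintype0 x T0.
have [v Dv] := eq_bigmax (@degree T) T0.
rewrite -/(max_degree T) in Dv.
have [D4|D4] := ltnP 3 (max_degree T).
  have KD := card_flags_at v.
  set K := [set p : flag T | _] in KD.
  apply: leq_trans (_ : uphalf #|K| <= k); first by rewrite Dv; exact: uphalf_leq.
  rewrite cardE; apply: (@clique_pages (complete_expansion T)) => //.
  - exact: enum_uniq.
  - move=> p q; rewrite !mem_enum !inE => /eqP pv /eqP qv.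
    by apply: expansion_adj_clique; rewrite pv.
  - by rewrite -cardE (leq_trans _ KD) // -Dv.
(* The remaining degrees 1 and 2 ask for one page, which a single edge forces. *)
have : 0 < degree v by rewrite -Dv.
case/card_gt0P => w; rewrite inE => vw.
have [p dp] := dart_surj vw.
have [|q dq] := @dart_surj T w v; first by rewrite adj_sym.
have /has_bookP[pos [page [_ lt_page _]]] := bk.
have := lt_page p q (expansion_adj_flip _); rewrite dp dq => /(_ erefl).
by lia.
Qed.

Theorem theorem3p4 (T : sgraph) (hT : is_tree T) (hD : max_degree T <> 3) :
  pagenumber (complete_expansion T) = uphalf (max_degree T).
Proof.
rewrite /pagenumber; case: ex_minnP => m bm min_m; apply/eqP; rewrite eqn_leq.
rewrite book_expansion_lower // andbT; apply: min_m; apply: has_book_expansion => //.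
by lia.
Qed.
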